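(* Let $AaBbCcDd$ be a normalized inscribed quadrilateral in $\mathbb{RP}^2$ (so $A=(0,0)$, $B=(1,1)$, $C=(0,2)$, $a\cap c=(-1,1)$, $D=(\mu,\nu)$), with edge parameters $Z,W\in(0,\infty)$. Then: (1) The line $AD$ has equation $y=\left(-\frac{2}{Z}-1\right)x$ and the line $CD$ has equation $y=(2W+1)x+2$. (2) With $V=\frac1Z$ and $F(V,W)=\frac{1}{W+V+1}$, the coordinates of $D$ are $\mu=-F(V,W)$ and $\nu=(1+2V)F(V,W)$. (3) The inverse relations are $W=\frac{2-\nu+\mu}{-2\mu}$ and $Z=\frac{-2\mu}{\mu+\nu}$. (4) If $Y$ is the triple ratio invariant of $ACD$ and $m$ is the slope of the line $d$ (for $d$ not vertical), then $$Y=\frac{(2-\nu+\mu)(\nu-\mu m)}{(\nu+\mu)(-2+\nu-\mu m)}.$$ (5) The reflection in the line $y=1$ fixes $B$ and $a\cap c$, interchanges the flags $Aa$ and $Cc$, reverses orientation, replaces $\nu$ with $2-\nu$, replaces $m$ with $-m$, and replaces $W$ with $1/Z$, $Z$ with $1/W$, and $Y$ with $1/Y$; that is, the normalized inscribed quadrilateral obtained by reflecting and then relabeling the images of $C$, $A$ as $A$, $C$ respectively (and correspondingly for the lines) has $(\mu,2-\nu)$, $-m$, $1/Z$, $1/W$, $1/Y$ in place of $(\mu,\nu)$, $m$, $W$, $Z$, $Y$.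
   Context: A flag in $\mathbb{RP}^2$ is a point on a line; $A$ denotes the point and $a$ the line of the flag $Aa$, and similarly for the other letters. Inscribed quadrilateral: four flags $AaBbCcDd$ such that, in some affine chart, $A,B,C,D$ are the vertices, in counterclockwise order, of a convex quadrilateral $ABCD$ (no three vertices collinear), each of the lines $a,b,c,d$ meets the closed quadrilateral $ABCD$ only in its own flag point, and no three of the lines are concurrent. Normalized: an element of $\mathrm{PGL}(3,\mathbb{R})$ has been applied so that in inhomogeneous coordinates $(x,y)$, $A=(0,0)$, $B=(1,1)$, $C=(0,2)$ and $a\cap c=(-1,1)$ (so $a$ is $y=-x$ and $c$ is $y=x+2$). Then $D=(\mu,\nu)$ lies in the open triangle with vertices $A$, $C$, $a\cap c$. Edge parameters: the cross ratio of four collinear points is $\frac{(x_1-x_2)(x_3-x_4)}{(x_1-x_4)(x_2-x_3)}$ in an affine coordinate on the line; the cross ratio of four concurrent lines is that of their intersections with a general line. $Z$ is the cross ratio of the lines $a,AB,AC,AD$ through $A$ (counterclockwise order, flag line first), and $W$ is the cross ratio of the lines $c,CD,CA,CB$ through $C$ (counterclockwise order, flag line first). Triple ratio: for flags $AaCcDd$, with $f_a,f_c,f_d$ linear functionals on $\mathbb{R}^3$ defining the lines and $\tilde A,\tilde C,\tilde D\in\mathbb{R}^3$ vectors representing the points, the triple ratio invariant of $ACD$ is $\frac{f_a(\tilde C)f_c(\tilde D)f_d(\tilde A)}{f_a(\tilde D)f_c(\tilde A)f_d(\tilde C)}$. *)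

(* Defs.v *)
(* The real numbers are an arbitrary [R : realType]. *)
From HB Require Import structures.
From mathcomp Require Import all_boot all_order all_algebra.
From mathcomp Require Import boolp classical_sets reals.
From mathcomp Require Import ring.

Set Implicit Arguments.
Unset Strict Implicit.
Unset Printing Implicit Defensive.

Import Order.TTheory GRing.Theory Num.Theory.
Local Open Scope ring_scope.
Local Open Scope classical_set_scope.

(* RP^2: points and lines are the 1- and 2-dimensional subspaces of R^3, so
   that incidence is inclusion, the line joining two points is [(P + Q)%VS],
   and the intersection of two lines is [(l :&: k)%VS]. *)
Notation subspace3 R := {vspace 'rV[R]_3}.

Record flag (R : realType) : Type := Flag {
  fpoint : subspace3 R;
  fline : subspace3 R;
  dim_fpoint : \dim fpoint == 1%N;
  dim_fline : \dim fline == 2%N;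
  fincident : (fpoint <= fline)%VS }.

Record quadruple (R : realType) : Type := Quadruple {
  flagA : flag R; flagB : flag R; flagC : flag R; flagD : flag R }.

Section Coordinates.
Variable R : realType.

Definition vec3 (x y w : R) : 'rV[R]_3 := \row_(i < 3) [:: x; y; w]`_i.

(* The point with inhomogeneous coordinates [p]. *)
Definition aff (p : R * R) : subspace3 R := <[vec3 p.1 p.2 1]>%VS.

(* Twice the signed area of the triangle [p q r]. *)
Definition orient (p q r : R * R) : R :=
  (q.1 - p.1) * (r.2 - p.2) - (q.2 - p.2) * (r.1 - p.1).

(* Each vertex lies strictly to the left of each directed edge [p1 p2],
   [p2 p3], [p3 p4], [p4 p1] that does not contain it. These are eight
   conditions, but they are pairwise equal up to cyclic rotation of the
   arguments of [orient]. In particular no three vertices are collinear. *)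
Definition ccw_convex (p1 p2 p3 p4 : R * R) : Prop :=
  [/\ 0 < orient p1 p2 p3, 0 < orient p2 p3 p4,
      0 < orient p3 p4 p1 & 0 < orient p4 p1 p2].

(* The convex hull of four points. *)
Definition closed_quad (p1 p2 p3 p4 : R * R) : set (R * R) :=
  [set p | exists t1 t2 t3 t4 : R,
    [/\ [&& 0 <= t1, 0 <= t2, 0 <= t3 & 0 <= t4],
        t1 + t2 + t3 + t4 = 1,
        p.1 = t1 * p1.1 + t2 * p2.1 + t3 * p3.1 + t4 * p4.1 &
        p.2 = t1 * p1.2 + t2 * p2.2 + t3 * p3.2 + t4 * p4.2]].

Definition has_equation (l : subspace3 R) (s k : R) : Prop :=
  forall x y : R, (aff (x, y) <= l)%VS <-> y = s * x + k.

Definition has_slope (l : subspace3 R) (s : R) : Prop :=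
  exists k : R, has_equation l s k.

End Coordinates.

Section Inscribed.
Variable R : realType.
Implicit Type q : quadruple R.

(* An affine chart is given by an invertible [g]: the points of the chart are
   the [P] whose image under [g] is some [aff p], and [p] is then the
   coordinate of [P]. *)
Definition inscribed_quadrilateral q : Prop :=
  let A := fpoint (flagA q) in let a := fline (flagA q) in
  let B := fpoint (flagB q) in let b := fline (flagB q) in
  let C := fpoint (flagC q) in let c := fline (flagC q) in
  let D := fpoint (flagD q) in let d := fline (flagD q) in
  (exists (g : 'End('rV[R]_3)) (pA pB pC pD : R * R),
    let Q := closed_quad pA pB pC pD in
    [/\ lker g = 0%VS,
        [/\ (g @: A)%VS = aff pA, (g @: B)%VS = aff pB,
            (g @: C)%VS = aff pC & (g @: D)%VS = aff pD],
        ccw_convex pA pB pC pD &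
        [/\ forall p, Q p -> (aff p <= g @: a)%VS -> p = pA,
            forall p, Q p -> (aff p <= g @: b)%VS -> p = pB,
            forall p, Q p -> (aff p <= g @: c)%VS -> p = pC &
            forall p, Q p -> (aff p <= g @: d)%VS -> p = pD]]) /\
  [/\ (a :&: b :&: c = 0)%VS, (a :&: b :&: d = 0)%VS,
      (a :&: c :&: d = 0)%VS & (b :&: c :&: d = 0)%VS].

Definition normalized q : Prop :=
  [/\ fpoint (flagA q) = aff (0, 0), fpoint (flagB q) = aff (1, 1),
      fpoint (flagC q) = aff (0, 2) &
      (fline (flagA q) :&: fline (flagC q))%VS = aff (- 1, 1)].

End Inscribed.

(* The invariants below are defined through a choice of coordinates, of a
   transversal line, or of representatives; the value does not depend on that
   choice, and [xget 0] picks it (with default [0]). *)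
Section Invariants.
Variable R : realType.
Implicit Types (P l : subspace3 R) (F : flag R) (q : quadruple R).

Definition cross_ratio (x1 x2 x3 x4 : R) : R :=
  ((x1 - x2) * (x3 - x4)) / ((x1 - x4) * (x2 - x3)).

(* For independent [o] and [e], [x |-> <[o + x *: e]>] is the inverse of an
   affine coordinate on the line spanned by [o] and [e], with [<[e]>] as the
   point at infinity. *)
Definition points_cross_ratio P1 P2 P3 P4 : R :=
  xget 0 [set z | exists (o e : 'rV[R]_3) (x1 x2 x3 x4 : R),
    [/\ free [:: o; e],
        [/\ P1 = <[o + x1 *: e]>%VS, P2 = <[o + x2 *: e]>%VS,
            P3 = <[o + x3 *: e]>%VS & P4 = <[o + x4 *: e]>%VS] &
        z = cross_ratio x1 x2 x3 x4]].

(* A line is general if it avoids the common point of the four lines. *)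
Definition lines_cross_ratio l1 l2 l3 l4 : R :=
  xget 0 [set z | exists l,
    [/\ \dim l = 2%N,
        \dim (l1 :&: l2 :&: l3 :&: l4) = 1%N,
        (l1 :&: l2 :&: l3 :&: l4 :&: l = 0)%VS &
        z = points_cross_ratio (l1 :&: l) (l2 :&: l) (l3 :&: l) (l4 :&: l)]].

Definition edge_Z q : R :=
  let A := fpoint (flagA q) in
  lines_cross_ratio (fline (flagA q)) (A + fpoint (flagB q))
    (A + fpoint (flagC q)) (A + fpoint (flagD q)).

Definition edge_W q : R :=
  let C := fpoint (flagC q) in
  lines_cross_ratio (fline (flagC q)) (C + fpoint (flagD q))
    (C + fpoint (flagA q)) (C + fpoint (flagB q)).

Definition triple_ratio (F1 F2 F3 : flag R) : R :=
  xget 0 [set z | exists (f1 f2 f3 : 'Hom('rV[R]_3, R^o)) (v1 v2 v3 : 'rV[R]_3),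
    [/\ [/\ lker f1 = fline F1, lker f2 = fline F2 & lker f3 = fline F3],
        [/\ <[v1]>%VS = fpoint F1, <[v2]>%VS = fpoint F2
          & <[v3]>%VS = fpoint F3] &
        z = ((f1 v2 : R) * f2 v3 * f3 v1) / ((f1 v3 : R) * f2 v1 * f3 v2)]].

Definition triple_ACD q : R := triple_ratio (flagA q) (flagC q) (flagD q).

Definition Fcoord (V W : R) : R := 1 / (W + V + 1).

End Invariants.

Section Transform.
Variables (R : realType) (g : 'End('rV[R]_3)).
Hypothesis injg : lker g = 0%VS.

Lemma dim_limg_inj (U : subspace3 R) : \dim (g @: U) = \dim U.
Proof. by apply: limg_dim_eq; rewrite injg capv0. Qed.

Definition map_flag (F : flag R) : flag R.
Proof.
apply: (@Flag R (g @: fpoint F)%VS (g @: fline F)%VS).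
- by rewrite dim_limg_inj dim_fpoint.
- by rewrite dim_limg_inj dim_fline.
- by apply: limgS; apply: fincident.
Defined.

End Transform.

Section Reflection.
Variable R : realType.

(* The reflection in the line y = 1. *)
Definition reflection (p : R * R) : R * R := (p.1, 2 - p.2).

Definition reverses_orientation (f : R * R -> R * R) : Prop :=
  forall p q r, 0 < orient p q r -> orient (f p) (f q) (f r) < 0.

Definition reflection_vec (v : 'rV[R]_3) : 'rV[R]_3 :=
  vec3 (v 0 0) (2 * v 0 2 - v 0 1) (v 0 2).

Lemma reflection_vec_linear : linear reflection_vec.
Proof.
move=> k u v; apply/rowP => i; rewrite !mxE.
by case: i => [[|[|[|i]]] hi] //=; rewrite ?mxE; ring.
Qed.

HB.instance Definition _ :=
  GRing.isLinear.Build R 'rV[R]_3 'rV[R]_3 _ reflection_vec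
    reflection_vec_linear.

(* The projective extension of [reflection], see [reflection_aff]. *)
Definition reflection_proj : 'End('rV[R]_3) := linfun reflection_vec.

Lemma reflection_aff (p : R * R) :
  (reflection_proj @: aff p)%VS = aff (reflection p).
Proof.
rewrite limg_line lfunE /=; congr <[_]>%VS.
by rewrite /reflection_vec !mxE /= mulr1.
Qed.

Lemma reflection_vecK : involutive reflection_vec.
Proof.
have subKr2 (x y : R) : 2 * y - (2 * y - x) = x by ring.
move=> v; apply/rowP => i; rewrite !mxE /= subKr2.
by case: i => [[|[|[|i]]] hi] //=; congr (fun_of_matrix v 0 _); apply/val_inj.
Qed.

Lemma reflection_inj : lker reflection_proj = 0%VS.
Proof.
apply/eqP/lker0P => u v; rewrite !lfunE /=.
exact: (can_inj reflection_vecK).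
Qed.

Definition reflect_flag : flag R -> flag R := map_flag reflection_inj.

(* Reflect, then exchange the labels A and C. *)
Definition reflect_relabel (q : quadruple R) : quadruple R :=
  Quadruple (reflect_flag (flagC q)) (reflect_flag (flagB q))
            (reflect_flag (flagA q)) (reflect_flag (flagD q)).

End Reflection.

(* Main.v *)
(* In the given chart, a line that meets the convex quadrilateral only in one
   vertex has the other three vertices strictly on one side, and the diagonal AC
   separates B from D. In normalized coordinates these facts place D in the open
   triangle with vertices A, C and the intersection of a and c. The four lines
   <[p]> + <[o + x_i *: e]> of a pencil have the cross ratio of the x_i, because
   two affine coordinates on transversals are related by a Moebius map. This
   expresses Z and W by mu and nu, and the remaining identities are algebra; for
   the reflected quadrilateral one applies the formulas to it, as it is again
   inscribed and normalized. *)
Require Import Defs.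
From HB Require Import structures.
From mathcomp Require Import all_boot all_order all_algebra.
From mathcomp Require Import boolp classical_sets reals.
From mathcomp Require Import ring lra.

Set Implicit Arguments.
Unset Strict Implicit.
Unset Printing Implicit Defensive.

Import Order.TTheory GRing.Theory Num.Theory.
Local Open Scope ring_scope.

Lemma divf_mull (K : fieldType) (x y s : K) :
  s != 0 -> (s * x) / (s * y) = x / y.
Proof. by move=> s0; rewrite -mulf_div divff // mul1r. Qed.

(** * Lines, planes and linear functionals in a vector space *)

Section LinearAlgebra.
Variables (K : fieldType) (vT : vectType K).
Implicit Types (u v w : vT) (U : {vspace vT}).

Lemma mem_lineDP u v w :
  reflect (exists a b, w = a *: u + b *: v) (w \in <[u]> + <[v]>)%VS.
Proof.
apply: (iffP memv_addP) => [[_ /vlineP[a ->] [_ /vlineP[b ->] ->]]|[a [b ->]]].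
  by exists a, b.
by exists (a *: u); last exists (b *: v); rewrite ?memvZ ?memv_line.
Qed.

Lemma free2P u v :
  reflect (forall a b, a *: u + b *: v = 0 -> a = 0 /\ b = 0)
    (free [:: u; v]).
Proof.
apply: (iffP (freeP (X := [tuple u; v]))) => [fr a b ab0|fr k].
  have := fr (fun i => [:: a; b]`_i).
  rewrite !big_ord_recl big_ord0 /= addr0 => /(_ ab0) k0.
  by split; [apply: (k0 0) | apply: (k0 1)].
rewrite !big_ord_recl big_ord0 /= addr0 => /fr[k0 k1].
by case=> [[|[|i]] hi] //; [rewrite -k0 | rewrite -k1]; congr k; apply/val_inj.
Qed.

Lemma free3P u v w :
  reflect
    (forall a b c, a *: u + b *: v + c *: w = 0 -> [/\ a = 0, b = 0 & c = 0])
    (free [:: u; v; w]).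
Proof.
apply: (iffP (freeP (X := [tuple u; v; w]))) => [fr a b c abc0|fr k].
  have := fr (fun i => [:: a; b; c]`_i).
  rewrite !big_ord_recl big_ord0 /= addr0 addrA => /(_ abc0) k0.
  by split; [apply: (k0 0) | apply: (k0 1) | apply: (k0 2)].
rewrite !big_ord_recl big_ord0 /= addr0 addrA => /fr[k0 k1 k2].
by case=> [[|[|[|i]]] hi] //; [rewrite -k0 | rewrite -k1 | rewrite -k2];
  congr k; apply/val_inj.
Qed.

Lemma dim_lineD u v : free [:: u; v] -> \dim (<[u]> + <[v]>)%VS = 2.
Proof. by rewrite -!span_seq1 -span_cat => /eqP. Qed.

Lemma span_lineD U u v :
  \dim U = 2 -> u \in U -> v \in U -> free [:: u; v] ->
  U = (<[u]> + <[v]>)%VS.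
Proof.
move=> dimU uU vU uv; apply/esym/eqP.
by rewrite eqEdim subv_add -!memvE uU vU dimU dim_lineD.
Qed.

Lemma vline_eq U u : (\dim U <= 1)%N -> u \in U -> u != 0 -> U = <[u]>%VS.
Proof.
by move=> dimU uU u0; apply/esym/eqP; rewrite eqEdim -memvE uU dim_vline u0.
Qed.

Lemma vlineZ u k : k != 0 -> <[k *: u]>%VS = <[u]>%VS.
Proof.
move=> k0; apply/eqP; rewrite eqEsubv -!memvE memvZ ?memv_line //=.
by apply/vlineP; exists k^-1; rewrite scalerA mulVf // scale1r.
Qed.

Lemma memvZ_eq U u k : k != 0 -> (k *: u \in U) = (u \in U).
Proof. by move=> k0; rewrite !memvE vlineZ. Qed.

(** A complement of [U] is spanned by one vector [w]. The functional is the [w]-coordinate of the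
    projection onto this complement along [U]. *)
Lemma functional_exists U : (\dim U).+1 = \dim {:vT} ->
  exists f : 'Hom(vT, K^o), lker f = U.
Proof.
move=> dimU.
have dimUC : \dim (U^C)%VS = 1 by rewrite dimv_compl -dimU subSnn.
have [w w0 UC_w] : exists2 w : vT, w != 0 & (U^C)%VS = <[w]>%VS.
  exists (vpick (U^C)%VS); first by rewrite vpick0 -dimv_eq0 dimUC.
  by apply: vline_eq; rewrite ?dimUC ?memv_pick // vpick0 -dimv_eq0 dimUC.
have UUC : (U^C :&: U)%VS = 0%VS by rewrite capvC capv_compl.
exists (linfun (coord [tuple w] 0 : vT -> K^o) \o daddv_pi U^C U)%VF.
apply/vspaceP => v; rewrite memv_ker comp_lfunE lfunE /=.
have v_dec : daddv_pi (U^C) U v + daddv_pi U (U^C) v = v.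
  by rewrite daddv_pi_add // addvC addv_complf memvf.
have /vlineP[k pi_v] : daddv_pi U^C U v \in <[w]>%VS by rewrite -UC_w memv_pi.
have -> : coord [tuple w] 0 (daddv_pi U^C U v) = k.
  have /coord_free w_free : free [tuple w] by rewrite seq1_free.
  by rewrite pi_v linearZ /= (w_free 0 0) eqxx mulr1.
apply/eqP/idP => [k0|vU].
  by rewrite -v_dec pi_v k0 scale0r add0r memv_pi.
have : daddv_pi U^C U v \in (U^C :&: U)%VS.
  rewrite memv_cap memv_pi /=.
  by rewrite -[X in X \in U](addrK (daddv_pi U U^C v)) v_dec rpredB // memv_pi.
by rewrite UUC memv0 pi_v scaler_eq0 (negPf w0) orbF => /eqP.
Qed.

(** For [u] outside the common kernel, [v - (f v / f u) *: u] is killed by [f], hence by [g], so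
    [k = g u / f u] works for all [v]. If both functionals vanish, [k = 1] serves. *)
Lemma proportional_functionals (f g : 'Hom(vT, K^o)) : lker f = lker g ->
  exists2 k : K, k != 0 & forall v, g v = k * (f v : K).
Proof.
move=> fg; have [f0|] := boolP (lker f == fullv).
  exists 1 => [|v]; first exact: oner_neq0.
  have : v \in lker f by rewrite (eqP f0) memvf.
  have : v \in lker g by rewrite -fg (eqP f0) memvf.
  by rewrite !memv_ker => /eqP-> /eqP->; rewrite mulr0.
move=> fN0; have [u uNf] : exists u, u \notin lker f.
  apply: contrapT => /forallNP all_f; case/negP: fN0.
  by apply/eqP/vspaceP => u; rewrite memvf; apply: contrapT => /negP/all_f.
have fu0 : f u != 0 by rewrite -memv_ker.
have gu0 : g u != 0 by rewrite -memv_ker -fg.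
exists (g u / f u) => [|v]; first by rewrite mulf_neq0 ?invr_eq0.
have : v - ((f v : K) / f u) *: u \in lker f.
  rewrite memv_ker linearB linearZ /= subr_eq0 [_ *: _]mulrVK ?unitfE //.
rewrite fg memv_ker linearB linearZ /= subr_eq0 => /eqP->.
by rewrite [LHS]mulrC mulrA mulrAC.
Qed.

End LinearAlgebra.

(** * Pencils of lines through a point and their cross ratios *)

Section Pencil.
Variable R : realType.
Implicit Types (u v : 'rV[R]_3) (l : subspace3 R).

Variables (p o e : 'rV[R]_3).
Hypothesis poe_free : free [:: p; o; e].

Let span_poe v : exists a b c, v = a *: p + b *: o + c *: e.
Proof.
have : v \in <<[:: p; o; e]>>%VS.
  suff -> : <<[:: p; o; e]>>%VS = fullv by rewrite memvf.
  by apply/eqP; rewrite eqEdim subvf (eqP poe_free) dimvf /dim /=.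
rewrite -[[:: p; o; e]]/([:: p] ++ [:: o] ++ [:: e]) !span_cat !span_seq1 addvA.
case/memv_addP => _ /mem_lineDP[a [b ->]] [_ /vlineP[c ->] ->].
by exists a, b, c.
Qed.

(** An affine coordinate on the pencil of lines through [p]: the line meets [<[o]> + <[e]>] at
    coordinate [x]. Only the line joining [p] and [e] is left out. *)
Definition pencil_line (x : R) : subspace3 R := (<[p]> + <[o + x *: e]>)%VS.

Lemma free_pencil x : free [:: p; o + x *: e].
Proof.
apply/free2P => a b; rewrite scalerDr scalerA addrA.
by case/(free3P _ _ _ poe_free).
Qed.

Lemma mem_pencil_line x a b c :
  (a *: p + b *: o + c *: e \in pencil_line x) = (c == b * x).
Proof.
apply/mem_lineDP/eqP => [[s [t /eqP]]|->]; last first.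
  by exists a, b; rewrite scalerDr scalerA addrA.
rewrite -subr_eq0 => eq_st.
have : (a - s) *: p + (b - t) *: o + (c - t * x) *: e = 0.
  rewrite -[RHS](eqP eq_st).
  by apply/rowP => i; rewrite !mxE; ring.
by case/(free3P _ _ _ poe_free) => _ /subr0_eq-> /subr0_eq->.
Qed.

(** Used to recognize the join of [p] with a given point as a member of the pencil: adding a
    multiple of [p] to the second generator, or rescaling it, does not change the span. *)
Lemma pencil_lineP x s t : t != 0 ->
  (<[p]> + <[s *: p + t *: (o + x *: e)]>)%VS = pencil_line x.
Proof.
move=> t0; have -> : s *: p + t *: (o + x *: e) =
    s *: p + t *: o + (t * x) *: e.
  by rewrite scalerDr scalerA addrA.
apply/esym/span_lineD.
- by rewrite dim_lineD // free_pencil.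
- by rewrite memvE addvSl.
- by rewrite mem_pencil_line.
- apply/free2P => a b ab0.
  have : (a + b * s) *: p + (b * t) *: o + (b * (t * x)) *: e = 0.
    by rewrite -[RHS]ab0; apply/rowP => i; rewrite !mxE; ring.
  case/(free3P _ _ _ poe_free) => a0 /eqP.
  rewrite mulf_eq0 (negPf t0) orbF => /eqP b0 _.
  by move: a0; rewrite b0 mul0r addr0.
Qed.

Lemma pencil_center x1 x2 : x1 != x2 ->
  (pencil_line x1 :&: pencil_line x2)%VS = <[p]>%VS.
Proof.
move=> x12; apply/eqP; rewrite eqEsubv; apply/andP; split.
  apply/subvP => v; rewrite memv_cap => /andP[].
  have [a [b [c ->]]] := span_poe v.
  rewrite !mem_pencil_line => /eqP-> /eqP/eqP.
  rewrite -subr_eq0 -mulrBr mulf_eq0 subr_eq0 (negPf x12) orbF => /eqP->.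
  by rewrite mul0r !scale0r !addr0 memvZ ?memv_line.
by rewrite subv_cap !addvSl.
Qed.

(** Were the intersection of dimension 2, it would be the whole line of the pencil, and [l] would
    contain [p]. *)
Lemma transversal_point l x u : p \notin l ->
  u \in l -> u != 0 -> u \in pencil_line x ->
  (pencil_line x :&: l)%VS = <[u]>%VS.
Proof.
move=> pl ul u0 ux; apply: vline_eq; rewrite ?memv_cap ?ux //.
rewrite leqNgt; apply: contra pl => dim_cap.
have : (pencil_line x :&: l)%VS == pencil_line x.
  by rewrite eqEdim capvSl dim_lineD ?free_pencil.
by move/eqP/capv_idPl/subvP; apply; rewrite memvE addvSl.
Qed.

Variables x1 x2 x3 x4 : R.
Hypothesis x12 : x1 != x2.

(** Projecting [o] and [e] from [p] into [l] gives coordinates on [l] in which the points have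
    parameters [x1], ..., [x4]. Any other coordinates differ from these by a Moebius map, which
    preserves the cross ratio. *)
Lemma points_cross_ratio_pencil l : \dim l = 2 -> p \notin l ->
  points_cross_ratio (pencil_line x1 :&: l) (pencil_line x2 :&: l)
    (pencil_line x3 :&: l) (pencil_line x4 :&: l) = cross_ratio x1 x2 x3 x4.
Proof.
move=> diml pl; have p0 : p != 0.
  by apply: contraNneq pl => ->; rewrite mem0v.
apply: xget_unique => [/=|z /= [o' [e' [y1 [y2 [y3 [y4]]]]]]].
  (* As [p] is off [l], subtracting multiples of [p] moves [o] and [e] into [l]; the line of
     parameter [x] keeps its parameter. *)
  have lp : (l + <[p]>)%VS = fullv.
    have lp0 : (l :&: <[p]>)%VS = 0%VS.
      apply/eqP; rewrite -subv0; apply/subvP => v; rewrite memv_cap memv0.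
      case/andP=> vl /vlineP[k vk]; move: vl; rewrite vk scaler_eq0.
      by have [->|k0] := eqVneq k 0; rewrite // memvZ_eq ?(negPf pl).
    apply/eqP; rewrite eqEdim subvf dimv_disjoint_sum // diml dim_vline p0.
    by rewrite dimvf.
  have proj v : exists2 k, v - k *: p \in l & True.
    have := memvf v; rewrite -lp => /memv_addP[w wl [_ /vlineP[k ->] ->]].
    by exists k; rewrite // addrK.
  have [s ol _] := proj o; have [t el _] := proj e.
  have pt x : (pencil_line x :&: l)%VS = <[o - s *: p + x *: (e - t *: p)]>%VS.
    have pt_eq : o - s *: p + x *: (e - t *: p)
        = (- s - x * t) *: p + 1 *: o + x *: e.
      by apply/rowP => i; rewrite !mxE; ring.
    apply: transversal_point; first by [].
    - by rewrite memvD ?memvZ.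
    - rewrite pt_eq; apply/eqP => /(free3P _ _ _ poe_free)[_ /eqP].
      by rewrite oner_eq0.
    - by rewrite pt_eq mem_pencil_line mul1r.
  exists (o - s *: p), (e - t *: p), x1, x2, x3, x4; split; rewrite ?pt //.
  apply/free2P => a b ab0.
  have : (- a * s - b * t) *: p + a *: o + b *: e = 0.
    by rewrite -[RHS]ab0; apply/rowP => i; rewrite !mxE; ring.
  by case/(free3P _ _ _ poe_free).
case=> fr' [P1 P2 P3 P4] ->.
have [a [b [c o'E]]] := span_poe o'; have [a' [b' [c' e'E]]] := span_poe e'.
have ptE y : o' + y *: e' =
    (a + y * a') *: p + (b + y * b') *: o + (c + y * c') *: e.
  by rewrite o'E e'E; apply/rowP => i; rewrite !mxE; ring.
(* The Moebius map [x = (c + y * c') / (b + y * b')] between the coordinates. Its denominator is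
   nonzero, since otherwise the point of [l] would be a multiple of [p]. *)
have pt x y : (pencil_line x :&: l)%VS = <[o' + y *: e']>%VS ->
    b + y * b' != 0 /\ c + y * c' = (b + y * b') * x.
  move=> P; have : o' + y *: e' \in (pencil_line x :&: l)%VS.
    by rewrite P memv_line.
  rewrite memv_cap => /andP[]; rewrite {1}ptE mem_pencil_line => /eqP cE yl.
  split=> //; apply/eqP => b0; move: yl.
  have y0 : o' + y *: e' != 0.
    apply/eqP => y0; have [|/eqP] := free2P _ _ fr' 1 y.
      by rewrite scale1r.
    by rewrite oner_eq0.
  move: y0; rewrite ptE cE b0 mul0r !scale0r !addr0 scaler_eq0 negb_or.
  by case/andP=> k0 _; rewrite memvZ_eq ?(negPf pl).
have [b1 c1] := pt _ _ P1; have [b2 c2] := pt _ _ P2.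
have [b3 c3] := pt _ _ P3; have [b4 c4] := pt _ _ P4.
(* The determinant of the Moebius map, which governs differences of parameters through [diff]. If it
   vanished, the map would send [y1] and [y2] to the same value, against [x1 != x2]. *)
pose delta := b * c' - c * b'.
have diff x y x' y' : c + y * c' = (b + y * b') * x ->
    c + y' * c' = (b + y' * b') * x' ->
    (b + y * b') * (b + y' * b') * (x - x') = delta * (y - y').
  move=> cx cx'; rewrite /delta mulrBr mulrAC -cx -mulrA -cx'; ring.
have delta0 : delta != 0.
  apply: contraNneq x12 => d0; have /eqP := diff _ _ _ _ c1 c2.
  by rewrite d0 mul0r !mulf_eq0 (negPf b1) (negPf b2) /= subr_eq0.
(* Each index occurs once in the numerator and once in the denominator of the cross ratio, so the
   product of the four Moebius denominators clears both, leaving the factor [delta ^+ 2] in each. *)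
pose k := (b + y1 * b') * (b + y2 * b') * ((b + y3 * b') * (b + y4 * b')).
have k0 : k != 0 by rewrite !mulf_neq0.
have delta20 : delta ^+ 2 != 0 by rewrite expf_neq0.
rewrite /cross_ratio -[LHS](divf_mull _ _ delta20) -[RHS](divf_mull _ _ k0).
congr (_ / _).
- by rewrite /k [RHS]mulrACA (diff _ _ _ _ c1 c2) (diff _ _ _ _ c3 c4); ring.
- have -> : k * ((x1 - x4) * (x2 - x3)) =
      (b + y1 * b') * (b + y4 * b') * (x1 - x4) *
      ((b + y2 * b') * (b + y3 * b') * (x2 - x3)) by rewrite /k; ring.
  by rewrite (diff _ _ _ _ c1 c4) (diff _ _ _ _ c2 c3); ring.
Qed.

(** The four lines have exactly [p] in common, so a general line is one that misses [p], and all of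
    these give the same value. The line through [o] and [e] shows that one exists. *)
Lemma lines_cross_ratio_pencil :
  lines_cross_ratio (pencil_line x1) (pencil_line x2) (pencil_line x3)
    (pencil_line x4) = cross_ratio x1 x2 x3 x4.
Proof.
have lines_capE : (pencil_line x1 :&: pencil_line x2 :&: pencil_line x3 :&:
    pencil_line x4)%VS = <[p]>%VS.
  rewrite pencil_center //.
  by rewrite (capv_idPl (addvSl _ _)) (capv_idPl (addvSl _ _)).
have p0 : p != 0.
  apply/eqP => p0; have [] := free3P _ _ _ poe_free 1 0 0.
    by rewrite p0 scaler0 !scale0r !addr0.
  by move/eqP; rewrite oner_eq0.
apply: xget_unique => [|z [l [diml _ pl ->]]]; last first.
  apply: points_cross_ratio_pencil => //.
  apply: contra p0 => pl'; rewrite -memv0 -pl memv_cap pl' andbT.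
  by rewrite lines_capE memv_line.
have diml : \dim (<[o]> + <[e]>)%VS = 2.
  rewrite dim_lineD //; apply/free2P => a b ab0.
  by have [] := free3P _ _ _ poe_free 0 a b; rewrite ?scale0r ?add0r.
have pl : p \notin (<[o]> + <[e]>)%VS.
  apply/mem_lineDP => -[a [b pE]].
  have [] := free3P _ _ _ poe_free (-1) a b.
    by rewrite scaleN1r -addrA -pE addNr.
  by move/eqP; rewrite oppr_eq0 oner_eq0.
exists (<[o]> + <[e]>)%VS; split=> //.
- by rewrite lines_capE dim_vline p0.
- rewrite lines_capE; apply/eqP; rewrite -subv0; apply/subvP => v.
  rewrite memv_cap memv0 => /andP[/vlineP[k ->]].
  have [->|k0] := eqVneq k 0; first by rewrite scale0r.
  by rewrite memvZ_eq ?(negPf pl).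
- by rewrite points_cross_ratio_pencil.
Qed.

End Pencil.

(** * Homogeneous coordinates, equations of lines and the triple ratio *)

Section Coordinates3.
Variable R : realType.
Implicit Types (p : R * R) (u v : 'rV[R]_3) (l U : subspace3 R).

Lemma vec3E (x y w : R) :
  (vec3 x y w 0 0 = x) * (vec3 x y w 0 1 = y) * (vec3 x y w 0 2 = w).
Proof. by rewrite !mxE. Qed.

Lemma vec3K v : vec3 (v 0 0) (v 0 1) (v 0 2) = v.
Proof.
apply/rowP => i; rewrite mxE.
by case: i => [[|[|[|i]]] hi] //=; congr (fun_of_matrix v 0 _); apply/val_inj.
Qed.

Lemma vec3D (x y w x' y' w' : R) :
  vec3 x y w + vec3 x' y' w' = vec3 (x + x') (y + y') (w + w').
Proof. by rewrite -[LHS]vec3K !mxE. Qed.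

Lemma vec3Z (k x y w : R) : k *: vec3 x y w = vec3 (k * x) (k * y) (k * w).
Proof. by rewrite -[LHS]vec3K !mxE. Qed.

Lemma vec3_inj (x y w x' y' w' : R) :
  vec3 x y w = vec3 x' y' w' -> [/\ x = x', y = y' & w = w'].
Proof.
move=> eq_v; split.
- by rewrite -(vec3E x y w).1.1 eq_v vec3E.
- by rewrite -(vec3E x y w).1.2 eq_v vec3E.
- by rewrite -(vec3E x y w).2 eq_v vec3E.
Qed.

Lemma vec3_eq0 (x y w : R) :
  vec3 x y w = 0 -> [/\ x = 0, y = 0 & w = 0].
Proof. by rewrite -[0]vec3K !mxE => /vec3_inj. Qed.

Definition form3 (a b c : R) (v : 'rV[R]_3) : R^o :=
  a * v 0 0 + b * v 0 1 + c * v 0 2.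

Fact form3_linear a b c : linear (form3 a b c).
Proof. by move=> k u v; rewrite /form3 !mxE [k *: _]mulrDr mulrDr; ring. Qed.

HB.instance Definition _ a b c :=
  GRing.isLinear.Build R 'rV[R]_3 R^o _ (form3 a b c) (form3_linear a b c).

Definition functional3 (a b c : R) : 'Hom('rV[R]_3, R^o) :=
  linfun (form3 a b c).

Lemma functional3E (a b c : R) v :
  functional3 a b c v = a * v 0 0 + b * v 0 1 + c * v 0 2 :> R.
Proof. by rewrite lfunE. Qed.

Lemma mem_lker3 (a b c x y w : R) :
  (vec3 x y w \in lker (functional3 a b c)) = (a * x + b * y + c * w == 0).
Proof. by rewrite memv_ker functional3E !vec3E. Qed.

(** Two independent vectors put [l] inside the kernel, and [w] shows that the kernel is not the
    whole space, so the dimensions agree. *)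
Lemma line_lker l (f : 'Hom('rV[R]_3, R^o)) u v w :
  \dim l = 2 -> u \in l -> v \in l -> free [:: u; v] ->
  u \in lker f -> v \in lker f -> w \notin lker f -> l = lker f.
Proof.
move=> diml ul vl uv fu fv fw; have lf : (l <= lker f)%VS.
  by rewrite (span_lineD diml ul vl uv) subv_add -!memvE fu fv.
apply/eqP; rewrite eqEdim lf diml leqNgt; apply: contra fw => dimf.
have /eqP fT : lker f == fullv by rewrite eqEdim subvf dimvf.
by rewrite fT memvf.
Qed.

Lemma free_vec3 (p q : R * R) : p != q ->
  free [:: vec3 p.1 p.2 1; vec3 q.1 q.2 1].
Proof.
move=> pq; apply/free2P => a b; rewrite !vec3Z vec3D => /vec3_eq0[].
rewrite !mulr1 => x0 y0 /eqP; rewrite addr_eq0 => /eqP ab.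
move: x0 y0; rewrite ab !mulNr => /eqP; rewrite addrC subr_eq0 => /eqP x0.
move/eqP; rewrite addrC subr_eq0 => /eqP y0.
have [->|b0] := eqVneq b 0; first by rewrite oppr0.
case/eqP: pq; rewrite [p]surjective_pairing [q]surjective_pairing.
by rewrite (mulfI b0 x0) (mulfI b0 y0).
Qed.

Lemma has_equation_join (p q : R * R) (s k : R) : p.1 != q.1 ->
  p.2 = s * p.1 + k -> q.2 = s * q.1 + k -> has_equation (aff p + aff q)%VS s k.
Proof.
move=> pq1 ps qs; have fr : free [:: vec3 p.1 p.2 1; vec3 q.1 q.2 1].
  by apply: free_vec3; apply: contraNneq pq1 => ->.
have -> : (aff p + aff q)%VS = lker (functional3 (- s) 1 (- k)).
  apply: (line_lker (u := vec3 p.1 p.2 1) (v := vec3 q.1 q.2 1)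
    (w := vec3 0 1 0) (dim_lineD fr)) => //.
  - by rewrite memvE; apply: addvSl.
  - by rewrite memvE; apply: addvSr.
  - by rewrite mem_lker3 ps; apply/eqP; ring.
  - by rewrite mem_lker3 qs; apply/eqP; ring.
  - by rewrite mem_lker3 !(mulr0, mulr1, addr0, add0r) oner_eq0.
move=> x y; rewrite -memvE mem_lker3 -subr_eq0.
have -> : - s * x + 1 * y + - k * 1 - 0 = y - (s * x + k) by ring.
by rewrite subr_eq0; split => /eqP.
Qed.

(** The equation speaks of affine points only; its points with abscissas 0 and 1 already span
    [l]. *)
Lemma has_equation_lker l (s k : R) : \dim l = 2 -> has_equation l s k ->
  l = lker (functional3 (- s) 1 (- k)).
Proof.
move=> diml eql.
have /eql l0 : k = s * 0 + k :> R by ring.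
have /eql l1 : s + k = s * 1 + k :> R by ring.
apply: (@line_lker _ _ (vec3 0 k 1) (vec3 1 (s + k) 1) (vec3 0 1 0)) => //.
- by apply: (@free_vec3 (0, k) (1, s + k)); rewrite xpair_eqE eq_sym oner_eq0.
- by rewrite mem_lker3; apply/eqP; ring.
- by rewrite mem_lker3; apply/eqP; ring.
- by rewrite mem_lker3 !(mulr0, mulr1, addr0, add0r) oner_eq0.
Qed.

Lemma flag_eq (F G : flag R) :
  fpoint F = fpoint G -> fline F = fline G -> F = G.
Proof.
case: F G => [P l dP dl Pl] [P' l' dP' dl' Pl'] /= PP' ll'.
move: dP dl Pl dP' dl' Pl'; rewrite PP' ll' => *.
by congr Flag; apply: bool_irrelevance.
Qed.

Lemma fpoint_generator (F : flag R) v : <[v]>%VS = fpoint F -> v != 0.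
Proof.
by move=> vF; have := dim_fpoint F; rewrite -vF dim_vline; case: (v != 0).
Qed.

(** Functionals and representatives are unique up to nonzero factors, and each of the six occurs
    once above and once below the fraction bar, so the factors cancel. *)
Lemma triple_ratioE (F1 F2 F3 : flag R) (f1 f2 f3 : 'Hom('rV[R]_3, R^o))
    (v1 v2 v3 : 'rV[R]_3) :
  lker f1 = fline F1 -> lker f2 = fline F2 -> lker f3 = fline F3 ->
  <[v1]>%VS = fpoint F1 -> <[v2]>%VS = fpoint F2 -> <[v3]>%VS = fpoint F3 ->
  triple_ratio F1 F2 F3 =
    ((f1 v2 : R) * f2 v3 * f3 v1) / ((f1 v3 : R) * f2 v1 * f3 v2).
Proof.
move=> f1F f2F f3F v1F v2F v3F; apply: xget_unique => /=.
  by exists f1, f2, f3, v1, v2, v3.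
move=> z [g1 [g2 [g3 [w1 [w2 [w3 [[g1F g2F g3F] [w1F w2F w3F] ->]]]]]]].
have vec_prop v w F : <[v]>%VS = fpoint F -> <[w]>%VS = fpoint F ->
    exists2 h : R, h != 0 & w = h *: v.
  move=> vF wF; have /vlineP[h wE] : w \in <[v]>%VS by rewrite vF -wF memv_line.
  exists h => //; have := fpoint_generator wF.
  by rewrite wE scaler_eq0 negb_or => /andP[].
have [h1 h10 ->] := vec_prop _ _ _ v1F w1F.
have [h2 h20 ->] := vec_prop _ _ _ v2F w2F.
have [h3 h30 ->] := vec_prop _ _ _ v3F w3F.
have [k1 k10 g1E] := proportional_functionals (etrans f1F (esym g1F)).
have [k2 k20 g2E] := proportional_functionals (etrans f2F (esym g2F)).
have [k3 k30 g3E] := proportional_functionals (etrans f3F (esym g3F)).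
have K0 : k1 * k2 * k3 * (h1 * h2 * h3) != 0 by rewrite !mulf_neq0.
rewrite -[RHS](divf_mull _ _ K0) !g1E !g2E !g3E !linearZ /=.
by congr (_ / _); rewrite /GRing.scale /=; ring.
Qed.

(** Scales the representative so that its image has last coordinate 1; affine combinations in the
    chart then lift to the same combinations of representatives. *)
Lemma chart_lift (g : 'End('rV[R]_3)) (P : subspace3 R) p :
  lker g = 0%VS -> (g @: P)%VS = aff p ->
  exists2 u, P = <[u]>%VS & g u = vec3 p.1 p.2 1.
Proof.
move=> /eqP g0 gP; have /memv_imgP[u _ gu] : vec3 p.1 p.2 1 \in (g @: P)%VS.
  by rewrite gP memv_line.
by exists u => //; apply/eqP; rewrite -(eq_limg_ker0 _ _ g0) limg_line gP -gu.
Qed.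

(* If [f] had weakly opposite signs at [u1] and [u2], it would vanish somewhere
   on the segment, necessarily at [p0], making [p0 p1 p2] collinear. *)
Lemma same_side (g : 'End('rV[R]_3)) (f : 'Hom('rV[R]_3, R^o))
    (p0 p1 p2 : R * R) u1 u2 :
  g u1 = vec3 p1.1 p1.2 1 -> g u2 = vec3 p2.1 p2.2 1 ->
  (forall t, 0 <= t <= 1 ->
    let p := ((1 - t) * p1.1 + t * p2.1, (1 - t) * p1.2 + t * p2.2) in
    (aff p <= g @: lker f)%VS -> p = p0) ->
  orient p0 p1 p2 != 0 -> 0 < (f u1 : R) * f u2.
Proof.
move=> gu1 gu2 segm orient0; rewrite ltNge; apply: contra orient0 => f12.
have [t t01 ft] : exists2 t : R, 0 <= t <= 1 & (1 - t) * f u1 + t * f u2 = 0.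
  have [f_eq|f_neq] := eqVneq (f u1 : R) (f u2).
    exists 0; rewrite ?lexx ?ler01 //.
    suff : (f u1 : R) = 0 by move=> ->; ring.
    by apply/eqP; rewrite -sqrf_eq0 eq_le sqr_ge0 expr2 {2}f_eq f12.
  have d0 : (f u1 : R) - f u2 != 0 by rewrite subr_eq0.
  have d2 : 0 < ((f u1 : R) - f u2) ^+ 2 by rewrite exprn_even_gt0.
  (* The zero of the affine function interpolating [f u1] and [f u2]. Writing it over a square makes
     the denominator positive whatever the signs are. *)
  exists ((f u1 : R) / ((f u1 : R) - f u2)); last by field.
  have -> : (f u1 : R) / ((f u1 : R) - f u2) =
      (f u1 : R) * ((f u1 : R) - f u2) / ((f u1 : R) - f u2) ^+ 2 by field.
  rewrite ler_pdivlMr // ler_pdivrMr //; apply/andP; split; nra.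
have := segm t t01; set p := (_, _) => /= p_eq.
have -> : p0 = p.
  apply/esym/p_eq; rewrite -memvE.
  have -> : vec3 p.1 p.2 1 = g ((1 - t) *: u1 + t *: u2).
    by rewrite linearD !linearZ /= gu1 gu2 !vec3Z vec3D /p /=; congr vec3; ring.
  by rewrite memv_img // memv_ker linearD !linearZ /= [X in X == _]ft.
by apply/eqP; rewrite /orient /p /=; ring.
Qed.

(* Applied to a functional vanishing at [p1] and [p3], this shows that the
   diagonal [p1 p3] separates [p2] from [p4]. *)
Lemma orient_relation (p1 p2 p3 p4 : R * R) :
  orient p2 p3 p4 *: vec3 p1.1 p1.2 1 - orient p3 p4 p1 *: vec3 p2.1 p2.2 1
  + orient p4 p1 p2 *: vec3 p3.1 p3.2 1 - orient p1 p2 p3 *: vec3 p4.1 p4.2 1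
  = 0.
Proof.
rewrite -!scaleNr !vec3Z !vec3D -[RHS]vec3K !mxE /orient.
by congr vec3; ring.
Qed.

End Coordinates3.

(** * The position of D and the invariants of a normalized quadrilateral *)

Section Normalized.
Variables (R : realType) (q : quadruple R).
Hypothesis normalized_q : normalized q.

Let dim_line (F : flag R) : \dim (fline F) = 2.
Proof. exact/eqP/dim_fline. Qed.

Lemma corner_mem : vec3 (- 1) 1 1 \in fline (flagA q) /\
  vec3 (- 1) 1 1 \in fline (flagC q).
Proof.
have [_ _ _ ac] := normalized_q.
have : vec3 (- 1) 1 1 \in (fline (flagA q) :&: fline (flagC q))%VS.
  by rewrite ac memv_line.
by rewrite memv_cap => /andP.
Qed.

Let free_corner (h : R) : free [:: vec3 0 h 1; vec3 (- 1) 1 1].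
Proof.
apply: (@free_vec3 _ (0, h) (- 1, 1)).
by rewrite xpair_eqE eq_sym oppr_eq0 oner_eq0.
Qed.

Lemma lineA_join : fline (flagA q) = (aff (0%R, 0%R) + aff (- 1, 1))%VS.
Proof.
have [qA _ _ _] := normalized_q; apply: span_lineD (dim_line _) _ _ _.
- by rewrite memvE -[X in (X <= _)%VS]qA fincident.
- by have [] := corner_mem.
- exact: (free_corner 0).
Qed.

Lemma lineC_join : fline (flagC q) = (aff (0%R, 2%R) + aff (- 1, 1))%VS.
Proof.
have [_ _ qC _] := normalized_q; apply: span_lineD (dim_line _) _ _ _.
- by rewrite memvE -[X in (X <= _)%VS]qC fincident.
- by have [] := corner_mem.
- exact: (free_corner 2).
Qed.

Lemma lineA_lker : fline (flagA q) = lker (functional3 1 1 0).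
Proof.
apply: (line_lker (u := vec3 0 0 1) (v := vec3 (- 1) 1 1) (w := vec3 0 1 0));
  rewrite ?dim_line ?mem_lker3 //.
- by rewrite memvE lineA_join; apply: addvSl.
- by have [] := corner_mem.
- by apply/eqP; ring.
- by apply/eqP; ring.
- by rewrite !(mulr0, mulr1, addr0, add0r) oner_eq0.
Qed.

Lemma lineC_lker : fline (flagC q) = lker (functional3 1 (- 1) 2).
Proof.
apply: (line_lker (u := vec3 0 2 1) (v := vec3 (- 1) 1 1) (w := vec3 1 0 0));
  rewrite ?dim_line ?mem_lker3 //.
- by rewrite memvE lineC_join; apply: addvSl.
- by have [] := corner_mem.
- by apply/eqP; ring.
- by apply/eqP; ring.
- by rewrite !(mulr0, mulr1, addr0, add0r) oner_eq0.
Qed.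

(** The lines [a] and [c] each have B and D on one side, and AC separates them. The representatives
    [uB] and [uD] carry factors of unknown sign, so every inequality is first obtained with the
    factor [kB]. *)
Lemma pointD_triangle : inscribed_quadrilateral q ->
  exists mu nu : R, [/\ fpoint (flagD q) = aff (mu, nu),
    mu < 0, 0 < mu + nu & 0 < 2 - nu + mu].
Proof.
case=> -[g [pA [pB [pC [pD [g0 [gA gB gC gD] [oABC oBCD oCDA oDAB]]]]]]].
rewrite lineA_lker lineC_lker => -[supA _ supC _] _.
have [qA qB qC _] := normalized_q.
have [uA AE guA] := chart_lift g0 gA; have [uB BE guB] := chart_lift g0 gB.
have [uC CE guC] := chart_lift g0 gC; have [uD DE guD] := chart_lift g0 gD.
have /vlineP[kA uAE] : uA \in aff (0, 0) by rewrite -qA AE memv_line.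
have /vlineP[kB uBE] : uB \in aff (1, 1) by rewrite -qB BE memv_line.
have /vlineP[kC uCE] : uC \in aff (0, 2) by rewrite -qC CE memv_line.
have lam1 (t : R) : 0 <= t <= 1 -> 0 <= 1 - t /\ 0 <= t.
  by case/andP=> t0 t1; rewrite subr_ge0.
have sideA : 0 < functional3 1 1 0 uB * functional3 1 1 0 uD :> R.
  apply: (same_side (p0 := pA) guB guD) => [t /lam1[t1 t0] /= |].
    (* These weights place the segment from [pB] to [pD] inside the quadrilateral. *)
    apply: supA; exists 0, (1 - t), 0, t => /=.
    by rewrite lexx t0 t1; split=> //; ring.
  suff : 0 < orient pA pB pD by case: ltgtP.
  by rewrite (_ : orient _ _ _ = orient pD pA pB) // /orient; ring.
have sideC : 0 < functional3 1 (- 1) 2 uB * functional3 1 (- 1) 2 uD :> R.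
  apply: (same_side (p0 := pC) guB guD) => [t /lam1[t1 t0] /= |].
    apply: supC; exists 0, (1 - t), 0, t => /=.
    by rewrite lexx t0 t1; split=> //; ring.
  suff : orient pC pB pD < 0 by case: ltgtP.
  by rewrite -oppr_gt0 (_ : - _ = orient pB pC pD) // /orient; ring.
(* In the first coordinate of the relation between the four vertices, A and C drop out because they
   lie on [x = 0]. Positive orientations then force opposite signs on [kB] and [x]. *)
have uD_x : - orient pC pD pA * kB = orient pA pB pC * uD 0 0.
  have : g (orient pB pC pD *: uA - orient pC pD pA *: uB
      + orient pD pA pB *: uC - orient pA pB pC *: uD) = 0.
    rewrite linearB linearD linearB !linearZ /= guA guB guC guD.
    by rewrite !scalerN orient_relation.
  move/eqP: g0 => /lker0P g_inj; rewrite -(linear0 g) => /g_inj.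
  move/rowP/(_ 0); rewrite uAE uBE uCE !mxE /= => eq0.
  by apply/subr0_eq; rewrite -[RHS]eq0; ring.
move: sideA sideC; rewrite !functional3E uBE !mxE /=.
set x := uD 0 0 in uD_x *; set y := uD 0 1; set w := uD 0 2 => sideA sideC.
have xneg : kB * x < 0.
  have kB0 : kB != 0.
    apply: contraTneq sideA => ->.
    by rewrite !(mul0r, mulr0, addr0) ltxx.
  have : 0 < kB ^+ 2 by rewrite exprn_even_gt0.
  by move: uD_x oABC oCDA; nra.
have kB_y : 0 < kB * (x + y) by lra.
have kB_w : 0 < kB * (x - y + 2 * w) by lra.
(* The sum of the two preceding inequalities is [0 < kB * (2 * x + 2 * w)], while [kB * x] is
   negative. In particular D is not at infinity. *)
have w0 : 0 < kB * w by lra.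
have /andP[kB0 wN0] : (kB != 0) && (w != 0).
  by rewrite -negb_or -mulf_eq0 gt_eqF.
exists (x / w), (y / w).
have frac (z : R) : z / w = kB * z / (kB * w) by field; rewrite kB0 wN0.
split.
- rewrite DE /aff /=.
  have -> : vec3 (x / w) (y / w) 1 = w^-1 *: uD.
    rewrite -(vec3K uD) vec3Z -/x -/y -/w mulVf //.
    by congr vec3; rewrite mulrC.
  by rewrite vlineZ // invr_eq0.
- by rewrite frac pmulr_llt0 // invr_gt0.
- by rewrite -mulrDl frac divr_gt0.
- have -> : 2 - y / w + x / w = kB * (x - y + 2 * w) / (kB * w).
    by field; rewrite kB0 wN0.
  by rewrite divr_gt0.
Qed.

Let free_vertex (h : R) : free [:: vec3 0 h 1; vec3 0 1 0; vec3 1 0 0].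
Proof.
apply/free3P => a b c; rewrite !vec3Z !vec3D => /vec3_eq0[].
rewrite !(mulr0, mulr1, addr0, add0r) => -> + a0.
by rewrite a0 mul0r add0r => ->.
Qed.

(** The parameter of a line through [(0, h)] is its inverse slope, so that the vertical line AC gets
    parameter 0. *)
Let pencil_vertexP (h x y : R) : y != h ->
  (aff (0%R, h) + aff (x, y))%VS =
  pencil_line (vec3 0 h 1) (vec3 0 1 0) (vec3 1 0 0) (x / (y - h)).
Proof.
move=> yh; have yh0 : y - h != 0 by rewrite subr_eq0.
rewrite -(pencil_lineP (free_vertex h) _ 1 yh0); congr (<[_]> + <[_]>)%VS.
by rewrite !(vec3Z, vec3D) /=; congr vec3; field.
Qed.

Variables mu nu : R.
Hypothesis qD : fpoint (flagD q) = aff (mu, nu).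
Hypotheses (mu_lt0 : mu < 0) (aD_gt0 : 0 < mu + nu) (cD_gt0 : 0 < 2 - nu + mu).

Let mu_neq0 : mu != 0. Proof. by rewrite lt_eqF. Qed.
Let nu_gt0 : 0 < nu. Proof. by move: mu_lt0 aD_gt0; lra. Qed.
Let nu_lt2 : nu < 2. Proof. by move: mu_lt0 cD_gt0; lra. Qed.

(** The lines [a], AB, AC, AD have inverse slopes -1, 1, 0 and [mu / nu]. *)
Lemma edge_ZE : edge_Z q = (- 2 * mu) / (mu + nu).
Proof.
have [qA qB qC _] := normalized_q.
have one0 : (1 : R) != 0 by rewrite oner_eq0.
have two0 : (2 : R) != 0 by rewrite pnatr_eq0.
have nu0 : nu != 0 by rewrite gt_eqF.
rewrite /edge_Z lineA_join qA qB qC qD !pencil_vertexP //.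
rewrite lines_cross_ratio_pencil // /cross_ratio.
  by field; rewrite nu0 mulN1r -opprD oppr_eq0 [nu + mu]addrC gt_eqF.
by rewrite subr0 !divr1 lt_eqF //; lra.
Qed.

(** The lines [c], CD, CA, CB have inverse slopes 1, [mu / (nu - 2)], 0 and -1. *)
Lemma edge_WE : edge_W q = (2 - nu + mu) / (- 2 * mu).
Proof.
have [qA qB qC _] := normalized_q.
have one2 : (1 : R) != 2 by rewrite lt_eqF // ltr1n.
have two0 : (0 : R) != 2 by rewrite eq_sym pnatr_eq0.
have nu2 : nu != 2 by rewrite lt_eqF.
rewrite /edge_W lineC_join qA qB qC qD !pencil_vertexP //.
rewrite lines_cross_ratio_pencil // /cross_ratio.
  by field; rewrite mu_neq0 subr_eq0 nu2.
(* It remains to see that [c] and CD are distinct, which holds because D lies strictly to one side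
   of [c]. *)
rewrite -subr_eq0.
rewrite (_ : _ - _ = (2 - nu + mu) / (2 - nu)); last first.
  by field; rewrite !subr_eq0 nu2 eq_sym nu2.
by rewrite mulf_neq0 ?invr_eq0 ?gt_eqF // subr_gt0.
Qed.

Lemma triple_ACD_slope (m : R) : has_slope (fline (flagD q)) m ->
  triple_ACD q = ((2 - nu + mu) * (nu - mu * m)) /
    ((nu + mu) * (- 2 + nu - mu * m)).
Proof.
case=> k eq_d; have [qA qB qC _] := normalized_q.
have nuE : nu = m * mu + k.
  by apply/eq_d; rewrite -qD fincident.
rewrite /triple_ACD (triple_ratioE (esym lineA_lker) (esym lineC_lker)
  (esym (has_equation_lker (dim_line _) eq_d)) (esym qA) (esym qC) (esym qD)).
(* With these representatives numerator and denominator share the factor -2; the intercept [k]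
   disappears because D lies on [d]. *)
have m2 : (-2 : R) != 0 by rewrite oppr_eq0 pnatr_eq0.
rewrite -[RHS](divf_mull _ _ m2) !functional3E !vec3E /=.
by congr (_ / _); rewrite nuE; ring.
Qed.

End Normalized.

(** * The reflection in [y = 1] followed by exchanging A and C *)

Section ReflectedQuadrilateral.
Variable R : realType.
Implicit Types (p : R * R) (U : subspace3 R) (F : flag R) (q : quadruple R).

Lemma reflectionK : involutive (@reflection R).
Proof. by case=> x y; rewrite /reflection /=; congr pair; ring. Qed.

Lemma orient_reflection (p1 p2 p3 : R * R) :
  orient (reflection p1) (reflection p2) (reflection p3) = - orient p1 p2 p3.
Proof. by rewrite /orient /reflection /=; ring. Qed.

Lemma mem_reflection U v :
  (v \in reflection_proj R @: U)%VS = (reflection_vec v \in U).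
Proof.
apply/memv_imgP/idP => [[u uU ->]|vU].
  by rewrite lfunE /= reflection_vecK.
by exists (reflection_vec v); rewrite // lfunE /= reflection_vecK.
Qed.

Lemma reflection_projK U :
  (reflection_proj R @: (reflection_proj R @: U))%VS = U.
Proof. by apply/vspaceP => v; rewrite !mem_reflection reflection_vecK. Qed.

Lemma aff_sub_reflection p U :
  (aff p <= reflection_proj R @: U)%VS = (aff (reflection p) <= U)%VS.
Proof.
rewrite -reflection_aff -{1}[aff p]reflection_projK.
by rewrite limg_ker0 ?reflection_inj.
Qed.

(** A functional for the image of a line is obtained by composing with the inverse map, here the
    reflection itself. *)
Lemma reflection_lker (f : 'Hom('rV[R]_3, R^o)) :
  lker (f \o reflection_proj R)%VF = (reflection_proj R @: lker f)%VS.
Proof.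
apply/vspaceP => v; rewrite mem_reflection !memv_ker comp_lfunE.
by rewrite [reflection_proj R v]lfunE.
Qed.

Lemma has_slope_reflection U (m : R) :
  has_slope U m -> has_slope (reflection_proj R @: U)%VS (- m).
Proof.
case=> k eqU; exists (2 - k) => x y; rewrite aff_sub_reflection eqU /=.
split=> [yE|->]; last by ring.
have -> : y = 2 - (2 - y) by ring.
by rewrite yE; ring.
Qed.

Lemma closed_quad_reflection (p1 p2 p3 p4 p : R * R) :
  closed_quad (reflection p1) (reflection p2) (reflection p3) (reflection p4) p
  -> closed_quad p3 p2 p1 p4 (reflection p).
Proof.
case=> t1 [t2 [t3 [t4 [/and4P[t10 t20 t30 t40] t1234 px py]]]].
exists t3, t2, t1, t4; rewrite t10 t20 t30 t40; split=> //.
- by rewrite -t1234; ring.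
- by rewrite /= px /=; ring.
(* The constant 2 in the reflected ordinate is absorbed because the weights sum to 1. *)
- have t4E : t4 = 1 - t1 - t2 - t3 by rewrite -t1234; ring.
  by rewrite /= py /= t4E; ring.
Qed.

(** Conjugating the chart map by the reflection reflects all chart coordinates. This reverses the
    orientation, and exchanging A and C reverses it again, so the vertices stay in counterclockwise
    order. *)
Lemma inscribed_reflect_relabel q :
  inscribed_quadrilateral q -> inscribed_quadrilateral (reflect_relabel q).
Proof.
case=> -[g [pA [pB [pC [pD [/eqP/lker0P g_inj [gA gB gC gD]]]]]]].
move=> [oABC oBCD oCDA oDAB] [supA supB supC supD] [abc abd acd bcd]; split.
  have g'E U : ((reflection_proj R \o g \o reflection_proj R) @:
      (reflection_proj R @: U))%VS = (reflection_proj R @: (g @: U))%VS.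
    by rewrite !limg_comp reflection_projK.
  have r_inj : injective (reflection_proj R).
    by apply/lker0P; rewrite reflection_inj.
  exists (reflection_proj R \o g \o reflection_proj R)%VF.
  exists (reflection pC), (reflection pB), (reflection pA), (reflection pD).
  rewrite /= !g'E gA gB gC gD !reflection_aff.
  have sup l P :
      (forall p, closed_quad pA pB pC pD p -> (aff p <= g @: l)%VS -> p = P) ->
    forall p, closed_quad (reflection pC) (reflection pB) (reflection pA)
        (reflection pD) p ->
      (aff p <= reflection_proj R @: (g @: l))%VS -> p = reflection P.
    move=> supl p /closed_quad_reflection Qp; rewrite aff_sub_reflection.
    by move=> /(supl _ Qp) <-; rewrite reflectionK.
  split=> //; last by split; apply: sup.
    apply/eqP/lker0P => u v; rewrite !comp_lfunE.
    by move=> /r_inj/g_inj/r_inj.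
  split; rewrite orient_reflection.
  - by rewrite (_ : - _ = orient pA pB pC) // /orient; ring.
  - by rewrite (_ : - _ = orient pD pA pB) // /orient; ring.
  - by rewrite (_ : - _ = orient pC pD pA) // /orient; ring.
  - by rewrite (_ : - _ = orient pB pC pD) // /orient; ring.
have r0 := introT eqP (reflection_inj R).
(* An injective map commutes with intersections, so the four triples of lines are images of the
   original ones, permuted by the exchange. *)
rewrite /= -!(lker0_img_cap _ _ r0); split.
- by rewrite capvC (capvC (fline (flagC q))) capvA abc limg0.
- by rewrite (capvC (fline (flagC q))) bcd limg0.
- by rewrite (capvC (fline (flagC q))) acd limg0.
- by rewrite (capvC (fline (flagB q))) abd limg0.
Qed.

(** Applying the reflection to all data changes no value of a functional, and exchanging the first
    two flags swaps numerator and denominator. Arguing from the definition also covers a vertical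
    [d]. *)
Lemma triple_ACD_reflect_relabel q :
  triple_ACD (reflect_relabel q) = 1 / triple_ACD q.
Proof.
have line_form F : exists f : 'Hom('rV[R]_3, R^o), lker f = fline F.
  by apply: functional_exists; rewrite (eqP (dim_fline F)) dimvf.
have point_vec F : exists v, <[v]>%VS = fpoint F.
  exists (vpick (fpoint F)); apply/esym/vline_eq.
  - by rewrite (eqP (dim_fpoint F)).
  - exact: memv_pick.
  - by rewrite vpick0 -dimv_eq0 (eqP (dim_fpoint F)).
have [fA fAE] := line_form (flagA q); have [fC fCE] := line_form (flagC q).
have [fD fDE] := line_form (flagD q).
have [vA vAE] := point_vec (flagA q); have [vC vCE] := point_vec (flagC q).
have [vD vDE] := point_vec (flagD q).
have lineE (f : 'Hom('rV[R]_3, R^o)) F : lker f = fline F ->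
    lker (f \o reflection_proj R)%VF = fline (reflect_flag F).
  by rewrite reflection_lker => ->.
have pointE v F : <[v]>%VS = fpoint F ->
    <[reflection_proj R v]>%VS = fpoint (reflect_flag F).
  by rewrite -limg_line => ->.
have rK v : reflection_proj R (reflection_proj R v) = v.
  by rewrite !lfunE /= reflection_vecK.
rewrite /triple_ACD (triple_ratioE fAE fCE fDE vAE vCE vDE).
rewrite (triple_ratioE (lineE _ _ fCE) (lineE _ _ fAE) (lineE _ _ fDE)
  (pointE _ _ vCE) (pointE _ _ vAE) (pointE _ _ vDE)) !comp_lfunE !rK.
by rewrite div1r invf_div; congr (_ / _); ring.
Qed.

Section NormalizedReflection.
Variable q : quadruple R.
Hypothesis normalized_q : normalized q.

(** Both [a] and [c] join their flag point to the corner [(-1, 1)], which is fixed, while [(0, 0)]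
    and [(0, 2)] are exchanged. *)
Lemma reflect_flagA : reflect_flag (flagA q) = flagC q.
Proof.
have [qA _ qC _] := normalized_q; apply: flag_eq.
  by rewrite /= qA qC reflection_aff /reflection /= subr0.
rewrite /= (lineC_join normalized_q) (lineA_join normalized_q) limgD.
rewrite !reflection_aff.
by rewrite /reflection /= subr0 (_ : 2 - 1 = 1 :> R) //; ring.
Qed.

Lemma reflect_flagC : reflect_flag (flagC q) = flagA q.
Proof.
rewrite -reflect_flagA; apply: flag_eq; exact: reflection_projK.
Qed.

Lemma reflectionB :
  (reflection_proj R @: fpoint (flagB q))%VS = fpoint (flagB q).
Proof.
have [_ -> _ _] := normalized_q; rewrite reflection_aff /reflection /=.
by rewrite (_ : 2 - 1 = 1 :> R) //; ring.
Qed.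

Lemma reflection_corner :
  (reflection_proj R @: (fline (flagA q) :&: fline (flagC q)))%VS =
  (fline (flagA q) :&: fline (flagC q))%VS.
Proof.
have [_ _ _ ->] := normalized_q; rewrite reflection_aff /reflection /=.
by rewrite (_ : 2 - 1 = 1 :> R) //; ring.
Qed.

Lemma normalized_reflect_relabel : normalized (reflect_relabel q).
Proof.
have [qA qB qC qac] := normalized_q.
rewrite /normalized /reflect_relabel reflect_flagA reflect_flagC /=.
by rewrite reflectionB.
Qed.

End NormalizedReflection.

End ReflectedQuadrilateral.

(** * Coordinates of D, edge parameters, triple ratio and their behavior under reflection *)

Theorem proposition2 (R : realType) (q : quadruple R)
    (inscribed_q : inscribed_quadrilateral q) (normalized_q : normalized q) :
  let A := fpoint (flagA q) in let a := fline (flagA q) in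
  let B := fpoint (flagB q) in
  let C := fpoint (flagC q) in let c := fline (flagC q) in
  let D := fpoint (flagD q) in let d := fline (flagD q) in
  let Z := edge_Z q in
  let W := edge_W q in
  let Y := triple_ACD q in
  let q' := reflect_relabel q in
  exists mu nu : R,
  [/\ D = aff (mu, nu), 0 < Z & 0 < W] /\
  [/\ (* (1) *)
      has_equation (A + D)%VS (- (2 / Z) - 1) 0 /\
      has_equation (C + D)%VS (2 * W + 1) 2,
      (* (2) *)
      let V := 1 / Z in
      mu = - Fcoord V W /\ nu = (1 + 2 * V) * Fcoord V W,
      (* (3) *)
      W = (2 - nu + mu) / (- 2 * mu) /\ Z = (- 2 * mu) / (mu + nu),
      (* (4) *)
      forall m : R, has_slope d m ->
        Y = ((2 - nu + mu) * (nu - mu * m)) /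
            ((nu + mu) * (- 2 + nu - mu * m)) &
      (* (5) *)
      [/\ (reflection_proj R @: B)%VS = B /\
          (reflection_proj R @: (a :&: c))%VS = (a :&: c)%VS,
          reflect_flag (flagA q) = flagC q /\ reflect_flag (flagC q) = flagA q,
          reverses_orientation (@reflection R),
          inscribed_quadrilateral q' /\ normalized q' &
          [/\ fpoint (flagD q') = aff (mu, 2 - nu),
              forall m : R, has_slope d m -> has_slope (fline (flagD q')) (- m),
              edge_W q' = 1 / Z,
              edge_Z q' = 1 / W &
              triple_ACD q' = 1 / Y]]].
Proof.
move=> A a B C c D d Z W Y q'.
have [mu [nu [qD mu_lt0 a_gt0 c_gt0]]] :=
  pointD_triangle normalized_q inscribed_q.
have [qA qB qC _] := normalized_q.
have inscribed_q' := inscribed_reflect_relabel inscribed_q.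
have normalized_q' := normalized_reflect_relabel normalized_q.
have q'D : fpoint (flagD q') = aff (mu, 2 - nu).
  by rewrite /= qD reflection_aff.
have ZE : Z = (- 2 * mu) / (mu + nu) by apply: edge_ZE.
have WE : W = (2 - nu + mu) / (- 2 * mu) by apply: edge_WE.
(* The formulas apply to [q'] with [2 - nu] for [nu]: this substitution exchanges the inequalities
   expressing that D lies inside [a] and inside [c]. *)
have Z'E : edge_Z q' = (- 2 * mu) / (mu + (2 - nu)).
  by apply: edge_ZE => //; lra.
have W'E : edge_W q' = (2 - (2 - nu) + mu) / (- 2 * mu).
  by apply: edge_WE => //; lra.
have mu0 : mu != 0 by rewrite lt_eqF.
have a0 : mu + nu != 0 by rewrite gt_eqF.
have c0 : 2 - nu + mu != 0 by rewrite gt_eqF.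
have mu2_gt0 : 0 < - 2 * mu by lra.
exists mu, nu; split.
  by split; rewrite ?ZE ?WE ?divr_gt0.
split.
- rewrite /A /C /D qA qC qD; split.
    apply: has_equation_join => /=; first by rewrite eq_sym.
      by ring.
    by rewrite ZE; field; rewrite mu0 a0.
  apply: has_equation_join => /=; first by rewrite eq_sym.
    by ring.
  by rewrite WE; field.
(* Over the common denominator [-2 * mu], the sum [W + V + 1] has numerator 2, whence
   [Fcoord V W = - mu]. *)
- have s0 : 2 - nu + mu + (mu + nu) + -2 * mu != 0.
    by rewrite (_ : _ + _ = 2) ?pnatr_eq0 //; ring.
  by rewrite /Fcoord ZE WE; split; field; rewrite a0 mu0.
- by [].
- exact: triple_ACD_slope.
split.
- by rewrite reflectionB // reflection_corner.
- by rewrite reflect_flagA // reflect_flagC.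
- by move=> p1 p2 p3; rewrite orient_reflection oppr_lt0.
- by [].
split=> //.
- exact: has_slope_reflection.
- by rewrite W'E ZE; field; rewrite mu0 a0.
- by rewrite Z'E WE; field; rewrite mu0 c0.
- by rewrite /q' triple_ACD_reflect_relabel.
Qed.
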